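(* For any hierarchy (depth $d$, branching factors $b_1,\dots,b_d$, constants $g_1\geq\dots\geq g_d=1$) and any $0\leq\epsilon<\frac1{k-1}$, there exist hypergraphs on which the hierarchical cost of the solution produced by the two-step method is at least $\frac{b_1-1}{b_1}\cdot g_1$ times the optimal hierarchical cost.
   Context: Let $G=(V,E)$ be a hypergraph with $n=|V|$. Hierarchy: a rooted tree of depth $d$ in which every node at depth $i-1$ has exactly $b_i$ children, so it has $k=\prod_{i=1}^d b_i$ leaves. A hierarchical partitioning is a partition of $V$ into $k$ parts each of size at most $(1+\epsilon)\frac nk$, with a bijective assignment of parts to leaves. For a hyperedge $e$ and $i\in[d]$, $\lambda_e^{(i)}$ is the number of depth-$i$ tree nodes whose subtree contains a leaf whose part intersects $e$, $\lambda_e^{(0)}=1$; the cost of $e$ is $\sum_{i=1}^d g_i(\lambda_e^{(i)}-\lambda_e^{(i-1)})$ and the hierarchical cost is the sum over $e\in E$. The two-step method: (i) compute an $\epsilon$-balanced $k$-way partitioning minimizing the connectivity cost $\sum_e(\lambda_e-1)$ ($\lambda_e$ = number of parts meeting $e$); (ii) assign these parts to the leaves so as to minimize the hierarchical cost.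
   Formalization: The last branching factor is assumed to satisfy b_d ≥ 2 (other b_i ≥ 1), since for b = (2,1), g = (100,1) the hierarchical cost is 100 times the connectivity cost, so the two-step method is optimal and the claimed factor 50 fails. *)

(* Defs.v *)
From HB Require Import structures.
From mathcomp Require Import all_boot all_order all_algebra.
From mathcomp Require Import reals.
Set Implicit Arguments.
Unset Strict Implicit.
Unset Printing Implicit Defensive.
Import Order.TTheory GRing.Theory Num.Theory.
Local Open Scope ring_scope.

(* Hyperedges are nonempty: an empty one would get the negative cost - g_1,
   because the depth-0 count is fixed to be 1. *)
Record hypergraph := Hypergraph {
  vertex :> finType;
  hyperedges : {set {set vertex}};
  hyperedges_neq0 : set0 \notin hyperedges }.

(* Branching factors b_1, ..., b_d are the values b 1, ..., b d of a function
   b : nat -> nat; likewise g_1, ..., g_d are g 1, ..., g d. Other values are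
   never used. *)
Definition nleaves (d : nat) (b : nat -> nat) : nat :=
  (\prod_(1 <= i < d.+1) b i)%N.

(* A node at depth i is the sequence of child indices on the path from the root
   to it; the step from depth j to depth j + 1 has b_{j+1} choices. *)
Definition node (b : nat -> nat) (i : nat) :=
  {dffun forall j : 'I_i, 'I_(b j.+1)}.

Definition address (b : nat -> nat) (i : nat) (x : node b i) : seq nat :=
  [seq (x j : nat) | j <- enum 'I_i].

Definition in_subtree (b : nat -> nat) (i j : nat)
    (x : node b i) (y : node b j) : bool :=
  prefix (address x) (address y).

Section Costs.

Context (R : realType) (G : hypergraph).

(* A k-way partitioning is given by the map sending a vertex to the label of its
   part. Empty parts are not excluded here, but for a nonempty vertex set and
   eps < 1/(k-1) the balance condition rules them out. *)
Definition part (k : nat) (f : {ffun G -> 'I_k}) (a : 'I_k) : {set G} :=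
  [set v | f v == a].

Definition balanced (k : nat) (eps : R) (f : {ffun G -> 'I_k}) : Prop :=
  forall a : 'I_k, #|part f a|%:R <= (1 + eps) * (#|G|%:R / k%:R).

Definition meets (k : nat) (f : {ffun G -> 'I_k}) (e : {set G}) (a : 'I_k) :
    bool :=
  part f a :&: e != set0.

Definition lambda (k : nat) (f : {ffun G -> 'I_k}) (e : {set G}) : nat :=
  #|[set a | meets f e a]|.

Definition connectivity_cost (k : nat) (f : {ffun G -> 'I_k}) : R :=
  \sum_(e in hyperedges G) ((lambda f e)%:R - 1).

Section Hierarchical.

Context (d : nat) (b : nat -> nat) (g : nat -> R).

Let k := nleaves d b.

Definition assignment (s : {ffun 'I_k -> node b d}) : Prop := bijective s.

Definition hlambda (f : {ffun G -> 'I_k}) (s : {ffun 'I_k -> node b d})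
    (e : {set G}) (i : nat) : nat :=
  if i == 0%N then 1%N
  else #|[set x : node b i |
           [exists a : 'I_k, in_subtree x (s a) && meets f e a]]|.

Definition edge_cost (f : {ffun G -> 'I_k}) (s : {ffun 'I_k -> node b d})
    (e : {set G}) : R :=
  \sum_(1 <= i < d.+1)
     g i * ((hlambda f s e i)%:R - (hlambda f s e i.-1)%:R).

Definition hierarchical_cost (f : {ffun G -> 'I_k})
    (s : {ffun 'I_k -> node b d}) : R :=
  \sum_(e in hyperedges G) edge_cost f s e.

Definition hierarchical_optimum (eps : R) (f : {ffun G -> 'I_k})
    (s : {ffun 'I_k -> node b d}) : Prop :=
  [/\ balanced eps f, assignment s &
      forall (f' : {ffun G -> 'I_k}) (s' : {ffun 'I_k -> node b d}),
        balanced eps f' -> assignment s' ->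
        hierarchical_cost f s <= hierarchical_cost f' s'].

(* Ties are possible in both steps, so the method is a relation: (f, s) is one
   of its possible outputs. *)
Definition two_step_output (eps : R) (f : {ffun G -> 'I_k})
    (s : {ffun 'I_k -> node b d}) : Prop :=
  [/\ balanced eps f,
      forall f' : {ffun G -> 'I_k},
        balanced eps f' -> connectivity_cost f <= connectivity_cost f',
      assignment s &
      forall s' : {ffun 'I_k -> node b d},
        assignment s' -> hierarchical_cost f s <= hierarchical_cost f s'].

End Hierarchical.

End Costs.

(* Main.v *)
Require Import Defs.
From HB Require Import structures.
From mathcomp Require Import all_boot all_order all_algebra.
From mathcomp Require Import reals.
From mathcomp Require Import boolp zify ring.
Set Implicit Arguments.
Unset Strict Implicit.
Unset Printing Implicit Defensive.
Import Order.TTheory GRing.Theory Num.Theory.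
Local Open Scope ring_scope.

(** Let L be the set of leaves, k = |L|, p = b_d, and t = k - p + 1. The
hypergraph is a weighted graph on k * t cells of equal size, so that a balanced
part holds exactly t cells (t <= k - 1 makes the slack eps * t smaller than one
cell). There are k central cells, forming a clique with edge weight p - 1; the
other cells form disjoint p-cliques, the blocks, with edge weight t + 1.

Since t = 1 mod p, a part without a central cell contains some block only
partially, and this costs more than what is saved by merging central cells. So
a partition of minimal connectivity has one central cell in each part, and
whatever the assignment, the fraction of the central edges crossing the top
level is k / (k - 1) * (b_1 - 1) / b_1.

On the other hand, one can move t of the central cells into a single leaf by
splitting some blocks evenly over the leaves of other groups of siblings. The
cut weight exceeds that of the former partition by a factor of at most
k / (k - 1), and all cut edges join sibling leaves, thus have cost g_d = 1.

Edge weights are realised by replacing each cell with a clique of m vertices,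
too expensive to be cut. *)

(** * Graphs as hypergraphs with two-element edges *)

Definition pair_edges (V : finType) (adj : rel V) : {set {set V}} :=
  [set [set p.1; p.2] | p : V * V & adj p.1 p.2].

Lemma pair_edges_neq0 (V : finType) (adj : rel V) :
  set0 \notin pair_edges adj.
Proof.
apply/imsetP => -[[x y] _ /= e0].
by have := set21 x y; rewrite -e0 inE.
Qed.

Lemma set2_inj (V : finType) (x y x' y' : V) :
  [set x'; y'] = [set x; y] -> (x', y') = (x, y) \/ (x', y') = (y, x).
Proof.
move=> e; have := set21 x' y'; have := set22 x' y'; have := set21 x y.
have := set22 x y; rewrite {1 2}e -{1 2}e !inE.
by do 4![case/orP => /eqP ?]; subst; auto.
Qed.

(** Each edge arises from exactly two ordered pairs, distinct because [adj] is irreflexive. Costs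
    below are therefore doubled and computed as double sums over vertices. *)
Lemma sum_pair_edges (M : nmodType) (V : finType) (adj : rel V)
    (F : {set V} -> M) :
  symmetric adj -> irreflexive adj ->
  (\sum_(e in pair_edges adj) F e) *+ 2 =
  \sum_x \sum_(y | adj x y) F [set x; y].
Proof.
move=> adjC adjxx.
rewrite pair_big_dep /=.
rewrite (partition_big (fun p => [set p.1; p.2]) (mem (pair_edges adj))) /=; last first.
  by move=> p adjp; apply: imset_f; rewrite inE.
rewrite -sumrMnl; apply: eq_bigr => e /imsetP[[x y]]; rewrite inE /= => adjxy ->.
have neqyx : (y, x) != (x, y).
  by rewrite xpair_eqE; apply: contraTN adjxy => /andP[/eqP-> _]; rewrite adjxx.
rewrite (bigD1 (x, y)) ?adjxy ?eqxx //=.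
rewrite (bigD1 (y, x)) ?(adjC y) ?adjxy ?neqyx ?(setUC [set x]) ?eqxx //=.
rewrite setUC big1 ?addr0 ?mulr2n // => -[x' y'] /= /andP[/andP[/andP[_ /eqP e'] n1] n2].
by case: (set2_inj e') => h; rewrite h eqxx in n1 n2.
Qed.

(** * Leaves with a common ancestor *)

(** Two leaves agree to depth [i] iff they lie below the same node of depth [i]; as a relation on
    leaves it avoids comparing nodes of different dependent types. *)
Definition agree (b : nat -> nat) (d i : nat) (z z' : node b d) : bool :=
  [forall j : 'I_d, (j < i)%N ==> (z j == z' j)].

Lemma agreeP (b : nat -> nat) (d i : nat) (z z' : node b d) :
  reflect (forall j : 'I_d, (j < i)%N -> z j = z' j) (agree i z z').
Proof.
apply: (iffP forallP) => h j; last by apply/implyP => /h ->.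
by move=> ji; apply/eqP/(implyP (h j)).
Qed.

Lemma agree_refl (b : nat -> nat) (d i : nat) (z : node b d) : agree i z z.
Proof. exact/agreeP. Qed.

Lemma agree_sym (b : nat -> nat) (d i : nat) (z z' : node b d) :
  agree i z z' = agree i z' z.
Proof. by apply/agreeP/agreeP => h j /h. Qed.

Lemma agree0 (b : nat -> nat) (d : nat) (z z' : node b d) : agree 0 z z'.
Proof. exact/agreeP. Qed.

Lemma agree_mono (b : nat -> nat) (d i i' : nat) (z z' : node b d) :
  (i' <= i)%N -> agree i z z' -> agree i' z z'.
Proof. by move=> ii' /agreeP h; apply/agreeP => j ji; apply/h/(leq_trans ji). Qed.

Lemma agree_depth (b : nat -> nat) (d : nat) (z z' : node b d) :
  agree d z z' = (z == z').
Proof.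
apply/agreeP/eqP => [h|-> //].
by apply/ffunP => j; apply: h.
Qed.

Definition ancestor (b : nat -> nat) (d i : nat) (id : (i <= d)%N)
    (z : node b d) : node b i :=
  [ffun j : 'I_i => (z (widen_ord id j) : 'I_(b j.+1))].

Lemma ancestor_eq (b : nat -> nat) (d i : nat) (id : (i <= d)%N)
    (z z' : node b d) :
  (ancestor id z == ancestor id z') = agree i z z'.
Proof.
apply/eqP/agreeP => [/ffunP h j ji|h].
  have hw : z (widen_ord id (Ordinal ji)) = z' (widen_ord id (Ordinal ji)).
    by have := h (Ordinal ji); rewrite !ffunE.
  have : j = widen_ord id (Ordinal ji) by apply: val_inj.
  by move: (widen_ord id (Ordinal ji)) hw => w hw ->.
by apply/ffunP => j; rewrite !ffunE; exact: (h (widen_ord id j) (ltn_ord j)).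
Qed.

Lemma size_address (b : nat -> nat) (i : nat) (x : node b i) :
  size (address x) = i.
Proof. by rewrite size_map size_enum_ord. Qed.

Lemma nth_address (b : nat -> nat) (i : nat) (x : node b i) (j : 'I_i) :
  nth 0%N (address x) j = x j.
Proof. by rewrite (nth_map j) ?size_enum_ord // nth_ord_enum. Qed.

Lemma in_subtreeE (b : nat -> nat) (d i : nat) (id : (i <= d)%N)
    (x : node b i) (z : node b d) :
  in_subtree x z = (x == ancestor id z).
Proof.
rewrite /in_subtree prefixE size_address.
have nthz (j : 'I_i) : nth 0%N (take i (address z)) j = ancestor id z j.
  by rewrite nth_take // ffunE -nth_address.
apply/eqP/eqP => [h|->].
  apply/ffunP => j; apply: val_inj => /=.
  by rewrite -nthz h nth_address.
apply: (@eq_from_nth _ 0%N).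
  by rewrite size_takel !size_address.
rewrite size_takel ?size_address // => j ji.
by rewrite (nthz (Ordinal ji)) -nth_address.
Qed.

Lemma card_agree (b : nat -> nat) (d i : nat) (z : node b d) :
  #|[set z' | agree i z z']| = (\prod_(j < d | i <= j) b j.+1)%N.
Proof.
pose F (j : 'I_d) : pred 'I_(b j.+1) := if (j < i)%N then pred1 (z j) else predT.
have -> : #|[set z' | agree i z z']| = #|(family F : pred (node b d))|.
  apply: eq_card => z'; rewrite inE.
  apply/agreeP/familyP => [h j|h j ji].
    by rewrite /F; case: ifP => // /h <-; rewrite inE.
  by have := h j; rewrite /F ji inE => /eqP ->.
rewrite card_family foldrE big_map big_enum /= [RHS]big_mkcond.
apply: eq_bigr => j _.
by rewrite /F ltnNge; case: leqP => _ /=; rewrite ?card1 ?card_ord.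
Qed.

Lemma card_leaves (b : nat -> nat) (d : nat) : #|node b d| = nleaves d b.
Proof.
rewrite card_dep_ffun foldrE big_map big_enum /= /nleaves big_add1 big_mkord.
by apply: eq_bigr => j _; rewrite card_ord.
Qed.

Lemma card_siblings (b : nat -> nat) (d : nat) (z : node b d.+1) :
  #|[set z' | agree d z z']| = b d.+1.
Proof.
rewrite card_agree big_mkcond big_ord_recr /= leqnn.
by rewrite big1 ?mul1n // => j _; rewrite leqNgt ltn_ord.
Qed.

Lemma card_same_child_of_root (b : nat -> nat) (d : nat) (z : node b d.+1) :
  (b 1 * #|[set z' | agree 1 z z']|)%N = nleaves d.+1 b.
Proof.
rewrite card_agree /nleaves big_add1 big_mkord big_mkcond !big_ord_recl /= mul1n.
by congr (_ * _)%N; apply: eq_bigr => j.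
Qed.

(** * Hierarchical cost of a single edge *)

Section PairCosts.

Context (R : realType) (G : hypergraph).

Lemma meetsP (k : nat) (f : {ffun G -> 'I_k}) (e : {set G}) (a : 'I_k) :
  reflect (exists2 v, v \in e & f v = a) (meets f e a).
Proof.
apply: (iffP (set0Pn _)) => [[v]|[v ve <-]].
  by rewrite !inE => /andP[/eqP fv ve]; exists v.
by exists v; rewrite !inE eqxx.
Qed.

Lemma lambda_pair (k : nat) (f : {ffun G -> 'I_k}) (x y : G) :
  lambda f [set x; y] = (f x != f y).+1.
Proof.
rewrite /lambda -cards2; apply: eq_card => a; rewrite inE.
apply/meetsP/set2P => [[v /set2P[->|->] <-]|[->|->]]; auto.
  by exists x; rewrite ?set21.
by exists y; rewrite ?set22.
Qed.

Context (d : nat) (b : nat -> nat) (g : nat -> R).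
Context (f : {ffun G -> 'I_(nleaves d b)}).
Context (s : {ffun 'I_(nleaves d b) -> node b d}).

Let loc (v : G) : node b d := s (f v).

Lemma hlambda_pair (x y : G) (i : nat) :
  (i <= d)%N -> hlambda f s [set x; y] i = (~~ agree i (loc x) (loc y)).+1.
Proof.
move=> id; rewrite /hlambda.
case: eqP => [->|_]; first by rewrite agree0.
rewrite -(ancestor_eq id) -cards2; apply: eq_card => w; rewrite inE.
apply/existsP/set2P => [[a /andP[]]|].
  by rewrite (in_subtreeE id) => /eqP-> /meetsP[v /set2P[->|->] <-]; auto.
case=> ->; [exists (f x) | exists (f y)]; rewrite (in_subtreeE id) eqxx.
  by apply/meetsP; exists x; rewrite ?set21.
by apply/meetsP; exists y; rewrite ?set22.
Qed.

(** The indicator of disagreement increases at most once, from 0 to 1 at the depth where the two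
    paths part, so an edge between distinct leaves costs the value of [g] there. *)
Lemma edge_cost_pair (x y : G) :
  edge_cost g f s [set x; y] =
  \sum_(0 <= i < d) g i.+1 * ((~~ agree i.+1 (loc x) (loc y))%:R
                              - (~~ agree i (loc x) (loc y))%:R).
Proof.
rewrite /edge_cost big_add1 !big_nat; apply: eq_bigr => i /= id.
rewrite !hlambda_pair ?(ltnW id) // -!natr1; congr (_ * _).
by rewrite opprD addrACA subrr addr0.
Qed.

Lemma disagree_increment_ge0 (z z' : node b d) (i : nat) :
  0 <= (~~ agree i.+1 z z')%:R - (~~ agree i z z')%:R :> R.
Proof.
rewrite subr_ge0 ler_nat.
by case: (boolP (agree i.+1 z z')) => [/(agree_mono (leqnSn i)) -> //|_]; case: agree.
Qed.

Hypothesis g_ge1 : forall i, (1 <= i <= d)%N -> 1 <= g i.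

Lemma edge_cost_ge_top (x y : G) :
  (0 < d)%N -> g 1%N * (~~ agree 1 (loc x) (loc y))%:R <= edge_cost g f s [set x; y].
Proof.
move=> d0; rewrite edge_cost_pair (big_ltn d0) agree0 subr0 lerDl big_nat.
apply: sumr_ge0 => i /andP[_ id].
by rewrite mulr_ge0 ?disagree_increment_ge0 // (le_trans ler01) // g_ge1.
Qed.

(** With every [g i] lowered to 1 the sum telescopes. *)
Lemma edge_cost_ge_separated (x y : G) :
  (loc x != loc y)%:R <= edge_cost g f s [set x; y].
Proof.
have -> : (loc x != loc y)%:R = \sum_(0 <= i < d)
    ((~~ agree i.+1 (loc x) (loc y))%:R - (~~ agree i (loc x) (loc y))%:R) :> R.
  by rewrite telescope_sumr // agree_depth agree0 subr0.
rewrite edge_cost_pair !big_nat; apply: ler_sum => i /= id.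
by rewrite ler_peMl ?disagree_increment_ge0 ?g_ge1.
Qed.

Lemma edge_cost_siblings (x y : G) :
  (0 < d)%N -> g d = 1 -> agree d.-1 (loc x) (loc y) ->
  edge_cost g f s [set x; y] = (loc x != loc y)%:R.
Proof.
move=> d0 gd ag; rewrite edge_cost_pair (big_cat_nat (n := d.-1)) ?leq_pred //=.
have dK := prednK d0.
rewrite (@big_ltn _ _ _ d.-1) ?ltn_predL // (@big_geq _ _ _ d.-1.+1) dK // gd ag agree_depth.
rewrite big_nat big1 => [|i /= id]; first by rewrite add0r addr0 mul1r subr0.
by rewrite (agree_mono id ag) (agree_mono (ltnW id) ag) subrr mulr0.
Qed.

End PairCosts.

(** * Cells, blocks and weights *)

Lemma dvdn_card_classes (T K : finType) (key : T -> K) (A : {set T}) (p : nat) :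
  (forall c, p %| #|[set x in A | key x == c]|)%N -> (p %| #|A|)%N.
Proof.
move=> h; rewrite -sum1_card (partition_big key predT) //=.
apply: dvdn_sum => c _; rewrite sum1dep_card; apply: h.
Qed.

Section Gadget.

Local Open Scope nat_scope.

Context (L P : finType) (par : L -> P) (z0 : L) (p : nat).
Hypothesis p_gt1 : 1 < p.
Hypothesis card_fiber : forall z, #|[set y | par y == par z]| = p.

(** The indices of the cells in a column: [z0] for the central cell, and the leaves outside the
    sibling group of [z0], grouped into blocks by their parent. *)
Let content := {y : L | (y == z0) || (par y != par z0)}.
Let k := #|L|.
Let t := #|{: content}|.

Definition center : content := exist _ z0 (introT orP (or_introl (eqxx z0))).

(* (x, y) lies in the column x of the connectivity-optimal partition. It is
   central if y = z0; otherwise its block is given by x and the parent of y. *)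
Definition cell := (L * content)%type.

Definition weight (u v : cell) : nat :=
  if par (val u.2) != par (val v.2) then 0
  else if val u.2 == z0 then p.-1
  else if u.1 == v.1 then t.+1 else 0.

Lemma content_eq0 (y : content) : (val y == z0) = (par (val y) == par z0).
Proof.
apply/eqP/eqP => [->//|h]; have /orP[/eqP //|] := valP y.
by rewrite h eqxx.
Qed.

Lemma weight_sym (u v : cell) : weight u v = weight v u.
Proof.
rewrite /weight eq_sym (eq_sym u.1) !content_eq0.
by case: eqP => //= ->.
Qed.

Lemma card_content : t + p = k.+1.
Proof.
have -> : t = #|z0 |: [set y | par y != par z0]|.
  by rewrite /t card_sig; apply: eq_card => y; rewrite !inE.
have := cardsC [set y | par y == par z0]; rewrite card_fiber /k => <-.
rewrite cardsU1 inE eqxx /= -addnA add1n addnC; congr (_ + _).+1.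
by apply: eq_card => y; rewrite !inE.
Qed.

Lemma dvdn_fiber_leaves : p %| k.
Proof.
rewrite /k -cardsT; apply: (@dvdn_card_classes _ _ par) => c.
case: (pickP [pred y | par y == c]) => [y /= /eqP <-|h].
  by under eq_finset do rewrite inE /=; rewrite card_fiber.
by rewrite eq_card0 // => y; rewrite !inE; apply: h.
Qed.

(** The leaves split into sibling groups of size [p], so [p] divides [k] and [t] = 1 mod [p]. *)
Lemma content_mod : ~~ (p %| t).
Proof.
apply: contraL p_gt1 => pt; rewrite -leqNgt dvdn_leq //.
rewrite -(@dvdn_addr k p 1) ?dvdn_fiber_leaves //.
by rewrite addn1 -card_content dvdn_addr.
Qed.

Lemma card_block (x : L) (c : P) (v : cell) :
  c != par z0 -> par (val v.2) = c ->
  #|[set u : cell | (u.1 == x) && (par (val u.2) == c)]| = p.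
Proof.
move=> c0 vc.
have -> : [set u : cell | (u.1 == x) && (par (val u.2) == c)] =
    setX [set x] [set y : content | par (val y) == c].
  by apply/setP => -[x' y]; rewrite !inE.
rewrite cardsX cards1 mul1n -(card_imset _ val_inj) -(card_fiber (val v.2)) vc.
apply: eq_card => y; rewrite inE; apply/imsetP/eqP => [[y' + ->]|yc].
  by rewrite inE => /eqP.
have hy : (y == z0) || (par y != par z0) by rewrite yc c0 orbT.
by exists (Sub y hy); rewrite ?inE /= ?yc.
Qed.

(** * Lower bound on the cut of a balanced partition of the cells *)

Section Cut.

Context (A : finType) (phi : cell -> A).
Hypothesis card_A : #|A| = k.
Hypothesis card_bin : forall a, #|[set u | phi u == a]| = t.

(** Ordered pairs are counted, so this is twice the usual cut weight. *)
Definition weighted_cut : nat := \sum_u \sum_(v | phi u != phi v) weight u v.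

Let bin_cut (a : A) := \sum_(u | phi u == a) \sum_(v | phi v != a) weight u v.
Let centers (a : A) := #|[set x | phi (x, center) == a]|.

Lemma weighted_cut_bins : weighted_cut = \sum_a bin_cut a.
Proof.
rewrite /weighted_cut (partition_big phi predT) //=.
apply: eq_bigr => a _; apply: eq_bigr => u /eqP ->.
by apply: eq_bigl => v; rewrite eq_sym.
Qed.

Lemma sum_centers_le (F : cell -> nat) (Q : pred cell) :
  \sum_(x | Q (x, center)) F (x, center) <= \sum_(u | Q u) F u.
Proof.
rewrite big_mkcond [leqRHS]big_mkcond /=.
have -> : \sum_u (if Q u then F u else 0) =
    \sum_x \sum_y (if Q (x, y) then F (x, y) else 0).
  by rewrite pair_bigA; apply: eq_bigr => -[].
by apply: leq_sum => x _; rewrite (bigD1 center) //= leq_addr.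
Qed.

Lemma centers_le (a : A) : centers a <= t.
Proof.
rewrite -(card_bin a) /centers -!sum1dep_card.
exact: (sum_centers_le (fun=> 1) (fun u => phi u == a)).
Qed.

Lemma sum_centers : \sum_a centers a = k.
Proof.
rewrite /k -cardsT -sum1_card (partition_big (fun x => phi (x, center)) predT) //=.
by apply: eq_bigr => a _; rewrite /centers -sum1dep_card; apply: eq_bigl => x; rewrite inE.
Qed.

Lemma bin_cut_centers (a : A) :
  p.-1 * (centers a * (k - centers a)) <= bin_cut a.
Proof.
apply: leq_trans (sum_centers_le _ (fun u => phi u == a)).
have hk : #|[set x | phi (x, center) != a]| = k - centers a.
  rewrite /k -(cardC [set x | phi (x, center) == a]) addKn.
  by apply: eq_card => x; rewrite !inE.
rewrite mulnCA {1}/centers -sum1dep_card big_distrl /=.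
apply: leq_sum => x _; rewrite mul1n.
apply: leq_trans (sum_centers_le _ (fun v => phi v != a)).
rewrite -hk mulnC -sum1dep_card big_distrl /=.
by apply: leq_sum => y _; rewrite /weight /= !eqxx mul1n.
Qed.

(* The blocks have p cells while a bin has t = 1 mod p of them, so a bin
   without central cells contains a block only partially. *)
Lemma bin_cut_no_center (a : A) : centers a = 0 -> t.+1 * p.-1 <= bin_cut a.
Proof.
move=> a0.
have Nc x : phi (x, center) != a.
  by apply: contraPN a0 => ax; rewrite /centers (cardsD1 x) inE ax.
pose B (u : cell) := [set w : cell | (w.1 == u.1) && (par (val w.2) == par (val u.2))].
have notcenter u : phi u == a -> val u.2 != z0.
  move=> ua; apply: contraTneq ua => u0.
  suff -> : u = (u.1, center) by apply: Nc.
  by rewrite [LHS]surjective_pairing; congr pair; apply: val_inj.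
have cardB u : phi u == a -> #|B u| = p.
  move=> /notcenter un; apply: (@card_block _ _ u) => //.
  by rewrite -content_eq0.
have [u [v [ua va uv]]] : exists u v, [/\ phi u == a, phi v != a & v \in B u].
  case: (boolP [exists u, exists v, [&& phi u == a, phi v != a & v \in B u]]).
    by move=> /existsP[u /existsP[v /and3P h]]; exists u, v.
  move=> N; case/negP: content_mod; rewrite -(card_bin a).
  apply: (@dvdn_card_classes _ _ (fun u : cell => (u.1, par (val u.2)))) => c.
  case: (pickP [pred u | (phi u == a) && ((u.1, par (val u.2)) == c)]) => [u /=|h].
    move=> /andP[ua /eqP <-]; rewrite -{1}(cardB u ua).
    suff -> : [set x in [set u | phi u == a] |
      (x.1, par (val x.2)) == (u.1, par (val u.2))] = B u by [].
    apply/setP => v; rewrite !inE xpair_eqE andbC.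
    apply: andb_idr => uv; apply: negbNE; apply: contraNN N => va.
    by apply/existsP; exists u; apply/existsP; exists v; rewrite ua va inE.
  by rewrite eq_card0 // => u; rewrite !inE; apply: h.
pose B1 := [set w in B u | phi w == a]; pose B2 := [set w in B u | phi w != a].
have cB : #|B1| + #|B2| = p.
  rewrite -(cardB u ua) -(cardsID [set w | phi w == a] (B u)).
  by congr (_ + _); apply: eq_card => w; rewrite !inE // andbC.
have B1_gt0 : 0 < #|B1| by apply/card_gt0P; exists u; rewrite !inE !eqxx.
have B2_gt0 : 0 < #|B2| by apply/card_gt0P; exists v; rewrite inE uv.
have wB w w' : w \in B1 -> w' \in B2 -> weight w w' = t.+1.
  rewrite !inE => /andP[/andP[/eqP w1 /eqP w2] wa] /andP[/andP[/eqP w1' /eqP w2'] _].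
  by rewrite /weight w2 w2' eqxx w1 w1' eqxx (negbTE (notcenter w wa)).
(* Two positive integers with sum [p] have product at least [p] - 1. *)
apply: leq_trans (_ : #|B1| * (#|B2| * t.+1) <= _).
  rewrite mulnA mulnC leq_mul2r /= -cB.
  case: #|B1| B1_gt0 => // m1 _; case: #|B2| B2_gt0 => // m2 _.
  by rewrite addSn /= mulSn addnC leq_add2l leq_pmulr.
rewrite -sum_nat_const.
rewrite /bin_cut [leqRHS](bigID (mem B1)) /=; apply: leq_trans (leq_addr _ _).
rewrite [leqRHS](eq_bigl (mem B1)); last first.
  by move=> w /=; rewrite !inE; case: eqP; rewrite ?andbF.
apply: leq_sum => w wB1.
rewrite -sum_nat_const [leqRHS](bigID (mem B2)) /=; apply: leq_trans (leq_addr _ _).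
rewrite [leqRHS](eq_bigl (mem B2)); last first.
  by move=> w' /=; rewrite !inE; case: eqP; rewrite ?andbF.
by apply: leq_sum => w' wB2; rewrite wB.
Qed.

(** The bound is linear in [centers a], so it can be summed over all bins; the indicator records the
    strict surplus of a bin without central cells. *)
Lemma bin_cut_lower (a : A) :
  p.-1 * k.-1 * centers a + p.-1 * t + (centers a == 0) <=
  bin_cut a + p.-1 * t * centers a.
Proof.
case: (posnP (centers a)) => [/[dup] /bin_cut_no_center h ->|n0].
  rewrite !muln0 add0n addn0 /=; apply: leq_trans h.
  by rewrite mulSn addnC mulnC leq_add2r -ltnS prednK // ltnW.
rewrite addn0; apply: leq_trans (leq_add (bin_cut_centers a) (leqnn _)).
have nk : centers a <= k by rewrite -sum_centers (bigD1 a) //= leq_addr.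
have nt := centers_le a.
rewrite -!mulnA -!mulnDr leq_mul2l; apply/orP; right.
move: nk nt n0; case: (centers a) => // n nk nt _.
(* For c central cells in the bin, the right side exceeds the left by (c - 1) * (t - c). *)
suff H k1 t1 : n < k1 -> n < t1 ->
    k1.-1 * n.+1 + t1 <= n.+1 * (k1 - n.+1) + t1 * n.+1 by apply: H.
move=> /subnKC <- /subnKC <-; rewrite addKn addSn /=; nia.
Qed.

(** There are as many bins as central cells, namely [k], so the terms with [t] cancel in the sum. *)
Lemma weighted_cut_ge :
  p.-1 * (k * k.-1) + #|[set a | centers a == 0]| <= weighted_cut.
Proof.
have := leq_sum (index_enum A) (P := predT) (fun a _ => bin_cut_lower a).
rewrite !big_split /= -!big_distrr /= !sum_centers sum_nat_const card_A.
have -> : \sum_i (centers i == 0 : nat) = #|[set a | centers a == 0]|.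
  by rewrite -sum1dep_card [RHS]big_mkcond; apply: eq_bigr => i _; case: eqP.
rewrite -weighted_cut_bins; move: p.-1 k.-1 => q k1; lia.
Qed.

(** Equality in the lower bound leaves no bin without a central cell, and a surjection between sets
    of size [k] is injective. *)
Lemma centers_separated :
  weighted_cut <= p.-1 * (k * k.-1) -> injective (fun x => phi (x, center)).
Proof.
move=> h; have := leq_trans weighted_cut_ge h.
rewrite -{2}[p.-1 * _]addn0 leq_add2l leqn0 cards_eq0 => /eqP e0.
suff : #|(fun x => phi (x, center)) @: [set: L]| == #|[set: L]|.
  by move=> /imset_injP inj x y; apply: inj; rewrite inE.
rewrite cardsT -/k -card_A -cardsT; apply/eqP; congr #|pred_of_set _|.
apply/setP => a; rewrite [RHS]inE; apply/imsetP.
have : a \notin [set a | centers a == 0] by rewrite e0 inE.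
rewrite inE -lt0n => /card_gt0P[x]; rewrite inE => /eqP <-.
by exists x.
Qed.

End Cut.


(** * Cuts of the column partition and of the swapped partition *)

Lemma cell_sum (F : cell -> nat) :
  \sum_u F u = \sum_x (F (x, center) + \sum_(y | val y != z0) F (x, y)).
Proof.
have -> : \sum_u F u = \sum_x \sum_y F (x, y).
  by rewrite pair_bigA; apply: eq_bigr => -[].
by apply: eq_bigr => x _; rewrite (bigD1 center).
Qed.

Lemma weight_center_row (x : L) (Q : pred cell) :
  \sum_(v | Q v) weight (x, center) v =
  p.-1 * #|[set x' | Q (x', center)]|.
Proof.
rewrite big_mkcond cell_sum /= mulnC -sum_nat_const [RHS]big_mkcond /=.
apply: eq_bigr => x' _; rewrite inE /weight /= !eqxx big1 ?addn0 // => y y0.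
by rewrite eq_sym -content_eq0 y0; case: ifP.
Qed.

Lemma weight_row (u : cell) (Q : pred cell) : val u.2 != z0 ->
  \sum_(v | Q v) weight u v =
  t.+1 * #|[set v : cell | Q v &
              (v.1 == u.1) && (par (val v.2) == par (val u.2))]|.
Proof.
move=> u0; rewrite mulnC -sum_nat_const big_mkcond [RHS]big_mkcond /=.
apply: eq_bigr => v _; rewrite inE /weight (negbTE u0) eq_sym (eq_sym u.1).
by case: (Q v); case: eqP => //=; case: eqP.
Qed.

(** Every block lies inside one column, so only edges between central cells are cut. *)
Lemma weighted_cut_columns (A : finType) (phi : L -> A) :
  injective phi -> weighted_cut (fun u => phi u.1) = p.-1 * (k * k.-1).
Proof.
move=> inj; rewrite /weighted_cut cell_sum /=.
rewrite (eq_bigr (fun=> p.-1 * k.-1)).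
  by rewrite sum_nat_const -/k mulnCA.
move=> x _; rewrite weight_center_row big1 ?addn0 => [|y y0].
  congr (_ * _); rewrite /k -(cardsC1 x).
  by apply: eq_card => x'; rewrite !inE (inj_eq inj) eq_sym.
rewrite weight_row //= eq_card0 ?muln0 // => v; rewrite inE.
by apply/negbTE/negP => /and3P[n /eqP vx _]; rewrite vx eqxx in n.
Qed.

(* Exchanges the central cell of the column y with the cell (z0, y): the central
   cells gather in the leaf z0, whose blocks get split over sibling leaves. *)
Definition swap (u : cell) : cell :=
  if val u.2 == z0 then oapp (pair z0) u (insub u.1)
  else if u.1 == z0 then (val u.2, center) else u.

Lemma swapK : involutive swap.
Proof.
move=> [x y]; rewrite {2}/swap /=; case: (eqVneq (sval y) z0) => [y0|y0].
  have -> : y = center by apply: val_inj.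
  case: insubP => [c _ cx|xn] /=; last by rewrite /swap /= eqxx insubN.
  rewrite /swap /= eqxx -cx; case: eqP => [c0|_]; last by [].
  rewrite insubT ?eqxx // => h /=.
  by congr pair; [rewrite c0 | apply: val_inj].
case: (eqVneq x z0) => [->|x0]; rewrite /swap /=; first by rewrite eqxx valK.
by rewrite (negbTE y0) (negbTE x0).
Qed.

Lemma card_swap_bin (x : L) : #|[set u | (swap u).1 == x]| = t.
Proof.
have -> : [set u | (swap u).1 == x] = swap @^-1: setX [set x] [set: content].
  by apply/setP => u; rewrite !inE andbT.
rewrite on_card_preimset; last by exists swap => u _; rewrite swapK.
by rewrite cardsX cards1 mul1n cardsT.
Qed.

Lemma swap_center (x : L) :
  (swap (x, center)).1 = if (x == z0) || (par x != par z0) then z0 else x.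
Proof.
rewrite /swap /= eqxx; case: insubP => [c /= -> //|/negbTE /= -> //].
Qed.

Lemma swap_noncenter (x : L) (y : content) : val y != z0 ->
  (swap (x, y)).1 = if x == z0 then val y else x.
Proof. by move=> y0; rewrite /swap /= (negbTE y0); case: ifP. Qed.

(** Central cells end up in [z0] or its siblings. A block of the column [z0] spreads over the
    sibling leaves that index it; any other block stays in its column. *)
Lemma swap_siblings (u v : cell) :
  u != v -> 0 < weight u v -> par (swap u).1 = par (swap v).1.
Proof.
case: u v => [x y] [x' y'] _; rewrite /weight /=.
case: eqP => //= pyy; case: eqP => [y0|/eqP y0].
  have y0' : val y' = z0 by apply/eqP; rewrite content_eq0 -pyy y0.
  have -> : y = center by apply: val_inj.
  have -> : y' = center by apply: val_inj.
  have ps w : par (swap (w, center)).1 = par z0.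
    by rewrite swap_center; case: ifP => // /norP[_ /negPn/eqP].
  by rewrite !ps.
case: eqP => // <- _; rewrite !swap_noncenter ?content_eq0 -?pyy -?content_eq0 //.
by case: ifP.
Qed.

(** With q = p - 1 and k = t + q, each of the t gathered central cells is cut from at most q others,
    each of the remaining q from at most k - 1, and each of the t - 1 noncentral cells of column
    [z0] from at most q neighbours of weight t + 1. The total q * (t * q + q * (k - 1) + (t - 1) *
    (t + 1)) equals q * (k * k - p). *)
Lemma weighted_cut_swap : weighted_cut (fun u => (swap u).1) <= p.-1 * (k * k).
Proof.
have tp := card_content.
have row_center x : \sum_(v | (swap (x, center)).1 != (swap v).1)
    weight (x, center) v <=
    p.-1 * if (x == z0) || (par x != par z0) then k - t else k.-1.
  rewrite weight_center_row leq_mul2l; apply/orP; right.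
  case: ifP => hx.
    have -> : k - t = #|~: [set y : L | (y == z0) || (par y != par z0)]|.
      rewrite cardsCs setCK /t card_sig; congr (_ - _).
      by apply: eq_card => y; rewrite !inE.
    apply: subset_leq_card; apply/subsetP => y; rewrite !inE !swap_center hx.
    by apply: contraNN => ->.
  have -> : k.-1 = #|[set~ x]| by rewrite cardsC1.
  apply: subset_leq_card; apply/subsetP => y; rewrite !inE.
  by apply: contraNneq => ->.
have row_noncenter x (y : content) : val y != z0 ->
    \sum_(v | (swap (x, y)).1 != (swap v).1) weight (x, y) v <=
    if x == z0 then t.+1 * p.-1 else 0.
  move=> y0; rewrite weight_row //; case: (eqVneq x z0) => [x0|x0] /=.
    pose B := [set u : cell | (u.1 == x) && (par (val u.2) == par (val y))].
    have cB : #|B| = p by apply: (@card_block _ _ (x, y)); rewrite -?content_eq0.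
    have -> : p.-1 = #|B :\ (x, y)| by rewrite -cB (cardsD1 (x, y) B) inE !eqxx.
    rewrite leq_mul2l; apply/orP; right.
    apply: subset_leq_card; apply/subsetP => v; rewrite !inE.
    by case/andP => h ->; rewrite andbT; apply: contraNneq h => ->.
  rewrite eq_card0 ?muln0 // => -[x' y']; rewrite !inE /=.
  apply/negP => /and3P[h /eqP xx /eqP yy]; case/negP: h.
  rewrite !swap_noncenter //; last by rewrite content_eq0 yy -content_eq0.
  by rewrite xx (negbTE x0).
rewrite /weighted_cut cell_sum big_split /=.
apply: leq_trans (leq_add (leq_sum _ (fun x _ => row_center x))
  (leq_sum _ (fun x _ => leq_sum _ (fun y y0 => row_noncenter x y y0)))) _.
rewrite -big_distrr /= [X in _ + X](bigD1 z0) //= eqxx [X in _ + (_ + X)]big1; last first.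
  by move=> x /negbTE ->; rewrite big1.
have tE : #|[pred y : content | val y != z0]| = t.-1.
  by rewrite /t -(cardsC1 center); apply: eq_card => y; rewrite !inE -val_eqE.
rewrite sum_nat_const tE (bigID (fun x => (x == z0) || (par x != par z0))) /=.
rewrite (eq_bigr (fun=> k - t)); last by move=> x ->.
rewrite [X in _ * (_ + X)](eq_bigr (fun=> k.-1)); last by move=> x /negbTE ->.
rewrite !sum_nat_const.
have -> : #|[pred x | (x == z0) || (par x != par z0)]| = t by rewrite /t card_sig.
have -> : #|[pred x | ~~ ((x == z0) || (par x != par z0))]| = k - t.
  rewrite /k -(cardC [pred x | (x == z0) || (par x != par z0)]) /t card_sig addKn.
  by apply: eq_card.
have t0 : 0 < t by apply/card_gt0P; exists center.
move: tp t0 p_gt1; move: k t p => k1 [//|t1] [//|q] /= tp _ _.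
have -> : k1 = t1 + q + 1 by lia.
have -> : (t1 + q + 1).-1 = t1 + q by lia.
have -> : t1 + q + 1 - t1.+1 = q by lia.
lia.
Qed.

End Gadget.

(** * Minimisers, and hypergraphs realising the weights *)

(** [balanced] and [assignment] are propositions, hence the classical passage to booleans. *)
Lemma exists_minimizer (R : realType) (T : finType) (Q : T -> Prop) (F : T -> R) :
  (exists x, Q x) -> exists2 x, Q x & forall y, Q y -> F x <= F y.
Proof.
case=> x0 Qx0; case: (@arg_minP _ R T x0 (fun x => `[< Q x >]) F); first exact/asboolP.
by move=> x /asboolP Qx h; exists x => // y /asboolP; apply: h.
Qed.

Section PairHypergraph.

Context (R : realType) (V : finType) (adj : rel V).
Hypotheses (adjC : symmetric adj) (adjxx : irreflexive adj).

Definition pair_hypergraph : hypergraph :=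
  @Hypergraph V (pair_edges adj) (pair_edges_neq0 adj).

Lemma connectivity_cost_pairs (k : nat) (f : {ffun pair_hypergraph -> 'I_k}) :
  connectivity_cost R f *+ 2 =
  (\sum_(x : V) \sum_(y | adj x y) (f x != f y))%:R.
Proof.
rewrite sum_pair_edges // natr_sum; apply: eq_bigr => x _.
rewrite natr_sum; apply: eq_bigr => y _.
by rewrite lambda_pair -natr1 addrK.
Qed.

Lemma hierarchical_cost_pairs (d : nat) (b : nat -> nat) (g : nat -> R)
    (f : {ffun pair_hypergraph -> 'I_(nleaves d b)})
    (s : {ffun 'I_(nleaves d b) -> node b d}) :
  hierarchical_cost g f s *+ 2 =
  \sum_(x : V) \sum_(y | adj x y) edge_cost g f s [set x; y].
Proof. exact: sum_pair_edges. Qed.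

End PairHypergraph.

Section Blowup.

Context (U : finType) (wt : U -> U -> nat) (m : nat).
Hypothesis wtC : forall u v, wt u v = wt v u.

(** Hyperedges form a set, so a weight cannot be a multiplicity: distinct cells are joined through
    copies of equal index, one edge for each index below the weight, and the copies of one cell form
    a clique. *)
Definition blowup_adj : rel (U * 'I_m) := fun x y =>
  if x.1 == y.1 then x.2 != y.2 else (x.2 == y.2) && (x.2 < wt x.1 y.1)%N.

Lemma blowup_adj_sym : symmetric blowup_adj.
Proof.
move=> [u a] [v c]; rewrite /blowup_adj /= eq_sym (eq_sym a) wtC.
by case: ifP => // _; case: eqP => // ->.
Qed.

Lemma blowup_adj_irrefl : irreflexive blowup_adj.
Proof. by move=> x; rewrite /blowup_adj !eqxx. Qed.

(** Clique edges contribute nothing because [F] vanishes on the diagonal, and [wt u v <= m] provides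
    enough copies. *)
Lemma sum_blowup (M : nmodType) (F : U -> U -> M) :
  (forall u, F u u = 0) -> (forall u v, (wt u v <= m)%N) ->
  \sum_x \sum_(y | blowup_adj x y) F x.1 y.1 = \sum_u \sum_v F u v *+ wt u v.
Proof.
move=> F0 wtm.
transitivity (\sum_u \sum_(a < m) \sum_v \sum_(c < m)
    if blowup_adj (u, a) (v, c) then F u v else 0).
  rewrite pair_bigA; apply: eq_bigr => -[u a] _ /=.
  by rewrite big_mkcond pair_bigA; apply: eq_bigr => -[v c].
apply: eq_bigr => u _; rewrite exchange_big; apply: eq_bigr => v _ /=.
rewrite /blowup_adj /=; case: eqP => [<-|_].
  by rewrite F0 mul0rn big1 // => a _; rewrite big1 // => c _; case: ifP.
transitivity (\sum_(a < m | (a < wt u v)%N) F u v).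
  rewrite [RHS]big_mkcond; apply: eq_bigr => a _.
  rewrite (bigD1 a) //= eqxx big1 ?addr0 // => c.
  by rewrite eq_sym => /negbTE ->.
by rewrite -(big_ord_widen _ (fun=> F u v) (wtm u v)) sumr_const card_ord.
Qed.

(* If a and c lie in different parts, every vertex of the clique is separated
   from a or from c. *)
Lemma split_clique_cut (A : eqType) (f : U * 'I_m -> A) (u : U) (a c : 'I_m) :
  f (u, a) != f (u, c) ->
  (m <= \sum_x \sum_(y | blowup_adj x y) (f x != f y))%N.
Proof.
move=> ac.
have -> : (\sum_x \sum_(y | blowup_adj x y) (f x != f y) =
    \sum_v \sum_(e < m) \sum_(y | blowup_adj (v, e) y) (f (v, e) != f y))%N.
  by rewrite pair_bigA; apply: eq_bigr => -[].
rewrite (bigD1 u) //= -[leqLHS]addn0 leq_add //.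
rewrite -{1}(card_ord m) -sum1_card; apply: leq_sum => e _.
have [w] : exists w, f (u, e) != f (u, w).
  case: (eqVneq (f (u, e)) (f (u, a))) => [->|]; first by exists c.
  by exists a.
move=> ew; rewrite (bigD1 (u, w)) /= ?ew ?leq_addr //.
by rewrite /blowup_adj /= eqxx; apply: contraNneq ew => ->.
Qed.

Lemma card_blowup_preim (A : {set U}) : #|[set x : U * 'I_m | x.1 \in A]| = (#|A| * m)%N.
Proof.
have -> : [set x : U * 'I_m | x.1 \in A] = setX A [set: 'I_m].
  by apply/setP => -[u a]; rewrite !inE andbT.
by rewrite cardsX cardsT card_ord.
Qed.

End Blowup.

(** * The hypergraph and its balanced partitions *)

Section Construction.

Context (R : realType) (d : nat) (b : nat -> nat) (g : nat -> R) (eps : R).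
Hypothesis b_last : (1 < b d.+1)%N.
Hypothesis g_ge1 : forall i, (1 <= i <= d.+1)%N -> 1 <= g i.
Hypothesis g_last : g d.+1 = 1.
Hypothesis eps_ge0 : 0 <= eps.

Let L := node b d.+1.
Let k := nleaves d.+1 b.
Let p := b d.+1.

Hypothesis eps_small : eps < 1 / (k%:R - 1).

Context (z0 : L).

Let par : L -> node b d := ancestor (leqnSn d).
Let cell := cell par z0.
Let center := center par z0.
Let wt : cell -> cell -> nat := weight p.
Let t := #|{: {y : L | (y == z0) || (par y != par z0)}}|.
(** Larger than twice the connectivity cost of the columns, so that splitting a cell never pays, and
    large enough for all weights to be realised. *)
Let m := (p.-1 * (k * k.-1) + p + t.+1)%N.
Let V := (cell * 'I_m)%type.
Let adj : rel V := @blowup_adj _ wt m.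
Let G := pair_hypergraph adj.

Lemma card_par_fiber (z : L) : #|[set y | par y == par z]| = p.
Proof.
rewrite -[RHS](card_siblings z); apply: eq_card => y.
by rewrite !inE ancestor_eq agree_sym.
Qed.

Let cardL : #|{: L}| = k := card_leaves b d.+1.

Lemma card_content_leaf : (t + p = k.+1)%N.
Proof. by rewrite -cardL; apply: card_content; apply: card_par_fiber. Qed.

Lemma wt_le (u v : cell) : (wt u v <= m)%N.
Proof.
rewrite /wt /weight /m -/t; case: ifP => // _; case: ifP => _.
  by rewrite -addnA addnCA (leq_trans (leq_pred p)) // leq_addr.
by case: ifP => // _; rewrite leq_addl.
Qed.

Let adjC : symmetric adj.
Proof. by apply: blowup_adj_sym; apply: weight_sym. Qed.

Let adjxx : irreflexive adj.
Proof. exact: blowup_adj_irrefl. Qed.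

Let m_gt0 : (0 < m)%N. Proof. by rewrite /m addnS. Qed.

Let t_gt0 : (0 < t)%N.
Proof. by apply/card_gt0P; exists center. Qed.

Let t_lt_k : (t < k)%N.
Proof. by rewrite -ltnS -card_content_leaf -addn1 ltn_add2l. Qed.

Lemma card_vertices : #|G| = (k * t * m)%N.
Proof. by rewrite [LHS]card_prod card_ord card_prod cardL. Qed.

Lemma average_part : #|G|%:R / k%:R = (t * m)%:R :> R.
Proof.
have k0 : (0 < k)%N by apply: leq_ltn_trans t_lt_k.
by rewrite card_vertices -mulnA natrM mulrC mulKf // pnatr_eq0 -lt0n.
Qed.

Section CellwisePartition.

Context (f : {ffun G -> 'I_k}) (phi : cell -> 'I_k).
Hypothesis f_phi : forall v : V, f v = phi v.1.

Lemma card_part_cellwise (a : 'I_k) :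
  #|part f a| = (#|[set u | phi u == a]| * m)%N.
Proof.
rewrite -card_blowup_preim; apply: eq_card => v.
by rewrite !inE f_phi.
Qed.

Lemma balanced_cellwise :
  (forall a, #|[set u | phi u == a]| = t) -> balanced eps f.
Proof.
move=> h a; rewrite average_part card_part_cellwise h.
by rewrite mulrDl mul1r lerDl mulr_ge0.
Qed.

(* Since t <= k - 1, the slack eps * t is less than one cell. *)
Lemma cellwise_balanced (a : 'I_k) :
  balanced eps f -> #|[set u | phi u == a]| = t.
Proof.
move=> bal; pose B a := #|[set u | phi u == a]|.
have B_le a' : (B a' <= t)%N.
  have := bal a'; rewrite average_part card_part_cellwise !natrM mulrA.
  rewrite ler_pM2r ?ltr0n // leqNgt => h; apply/negP => tB.
  have k1 : 0 < k%:R - 1 :> R.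
    by rewrite subr_gt0 ltr1n (leq_ltn_trans t_gt0 t_lt_k).
  have tk : t%:R <= k%:R - 1 :> R by rewrite lerBrDr natr1 ler_nat.
  have : t%:R + 1 <= (1 + eps) * t%:R :> R.
    by apply: le_trans h; rewrite natr1 ler_nat.
  rewrite mulrDl mul1r lerD2l leNgt => /negP; apply.
  move: eps_small; rewrite ltr_pdivlMr // => h1.
  by apply: le_lt_trans h1; rewrite ler_wpM2l.
(* No bin exceeds [t] and the average is exactly [t], so a smaller bin would leave some cell
   unplaced. *)
apply/eqP; move: (B_le a); rewrite -/(B a) leq_eqVlt => /orP[//|Ba].
have : (\sum_a' B a' < \sum_(a' : 'I_k) t)%N.
  by rewrite (bigD1 a) //= [ltnRHS](bigD1 a) //= -addSn leq_add // leq_sum.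
rewrite sum_nat_const card_ord.
have -> : (\sum_a' B a' = #|{: cell}|)%N.
  rewrite -cardsT -sum1_card (partition_big phi predT) //=.
  apply: eq_bigr => a' _; rewrite /B -sum1dep_card.
  by apply: eq_bigl => u; rewrite inE.
by rewrite card_prod cardL ltnn.
Qed.

Lemma connectivity_cost_cellwise :
  connectivity_cost R f *+ 2 = (weighted_cut p phi)%:R.
Proof.
rewrite connectivity_cost_pairs //; congr _%:R.
transitivity (\sum_(x : V) \sum_(y | adj x y) (phi x.1 != phi y.1 : nat))%N.
  by apply: eq_bigr => x _; apply: eq_bigr => y _; rewrite !f_phi.
rewrite (@sum_blowup _ _ _ nat (fun u v => (phi u != phi v : nat))).
- apply: eq_bigr => u _; rewrite [RHS]big_mkcond; apply: eq_bigr => v _.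
  by case: eqP => _ /=; [apply: mul0rn | apply: natn].
- by move=> u; rewrite eqxx.
- exact: wt_le.
Qed.

End CellwisePartition.

(** * Costs of the explicit partitions and of cheap partitions *)

(** Parts are labelled by ordinals and columns by leaves; under this bijection [leaf_assignment]
    sends each column to its own leaf. *)
Definition column_label (z : L) : 'I_k := cast_ord cardL (enum_rank z).
Definition label_leaf (a : 'I_k) : L := enum_val (cast_ord (esym cardL) a).

Lemma column_labelK : cancel column_label label_leaf.
Proof. by move=> z; rewrite /label_leaf cast_ordK enum_rankK. Qed.

Lemma label_leafK : cancel label_leaf column_label.
Proof. by move=> a; rewrite /column_label enum_valK cast_ordKV. Qed.


Definition column_partition : {ffun G -> 'I_k} :=
  [ffun v : V => column_label v.1.1].
Definition swap_partition : {ffun G -> 'I_k} :=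
  [ffun v : V => column_label (swap v.1).1].
Definition leaf_assignment : {ffun 'I_k -> L} := [ffun a => label_leaf a].

Lemma leaf_assignment_bij : assignment leaf_assignment.
Proof.
exists column_label => x; rewrite ffunE; first exact: label_leafK.
exact: column_labelK.
Qed.

Lemma column_partition_balanced : balanced eps column_partition.
Proof.
apply: (@balanced_cellwise _ (fun u => column_label u.1)) => [v|a].
  by rewrite ffunE.
have -> : [set u : cell | column_label u.1 == a] =
    setX [set label_leaf a] [set: {y : L | (y == z0) || (par y != par z0)}].
  apply/setP => -[x y]; rewrite !inE andbT /=.
  by rewrite (can2_eq column_labelK label_leafK).
by rewrite cardsX cards1 mul1n cardsT.
Qed.

Lemma swap_partition_balanced : balanced eps swap_partition.
Proof.
apply: (@balanced_cellwise _ (fun u => column_label (swap u).1)) => [v|a].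
  by rewrite ffunE.
rewrite -[RHS](card_swap_bin par z0 (label_leaf a)).
by apply: eq_card => u; rewrite !inE (can2_eq column_labelK label_leafK).
Qed.

Lemma column_partition_cost :
  connectivity_cost R column_partition *+ 2 = (p.-1 * (k * k.-1))%:R.
Proof.
rewrite (@connectivity_cost_cellwise _ (fun u => column_label u.1)).
  by rewrite weighted_cut_columns ?cardL //; apply: can_inj column_labelK.
by move=> v; rewrite ffunE.
Qed.

(** Meant for minimisers of connectivity: cutting a clique of copies is too expensive, so the
    partition is one of cells, and [centers_separated] applies. *)
Lemma cheap_partition_cellwise (f : {ffun G -> 'I_k}) :
  balanced eps f -> connectivity_cost R f <= connectivity_cost R column_partition ->
  exists2 phi : cell -> 'I_k, forall v : V, f v = phi v.1 &
    injective (fun x => phi (x, center)).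
Proof.
move=> bal; rewrite -(ler_pMn2r (ltn0Sn 1)) column_partition_cost => cost.
pose phi (u : cell) := f (u, Ordinal m_gt0).
have f_phi (v : V) : f v = phi v.1.
  case: v => u a; apply/eqP; apply: contraLR cost => split_u.
  rewrite connectivity_cost_pairs // ler_nat -ltnNge.
  apply: leq_trans (@split_clique_cut _ wt m _ f u a (Ordinal m_gt0) split_u).
  by rewrite /m -addnA -[ltnLHS]addn0 ltn_add2l addnS.
exists phi => //.
have card_bin a : #|[set u | phi u == a]| = t by apply: cellwise_balanced bal.
apply: (@centers_separated _ _ par z0 p b_last card_par_fiber _ phi) => //.
  by rewrite card_ord cardL.
by rewrite cardL -(ler_nat R) -(connectivity_cost_cellwise f_phi).
Qed.

(** A partition of cost at most zero is no dearer than the columns, hence respects cells, and then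
    [weighted_cut_ge] makes its cost positive. *)
Lemma balanced_cost_gt0 (f : {ffun G -> 'I_k}) :
  balanced eps f -> 0 < connectivity_cost R f.
Proof.
move=> bal; rewrite ltNge; apply/negP => cost0.
have [||phi f_phi _] := @cheap_partition_cellwise f => //.
  apply: le_trans cost0 _.
  by rewrite -(pmulrn_lge0 _ (ltn0Sn 1)) column_partition_cost.
have card_bin a : #|[set u | phi u == a]| = t by apply: cellwise_balanced bal.
have := @weighted_cut_ge _ _ par z0 p b_last card_par_fiber _ phi.
rewrite card_ord cardL => /(_ erefl card_bin) /(leq_trans (leq_addr _ _)).
rewrite leqNgt => /negP; apply.
apply: (@leq_ltn_trans 0%N).
  by rewrite -(ler_nat R) -(connectivity_cost_cellwise f_phi) pmulrn_lle0.
have := t_lt_k; have := t_gt0; have := b_last; rewrite -/p => p1 t0 tk.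
rewrite !muln_gt0; move: p1 t0 tk; move: p t k => p1 t1 k1; lia.
Qed.

(** All [g i] are at least 1, so the hierarchical cost is at least the connectivity cost. *)
Lemma hierarchical_cost_gt0 (f : {ffun G -> 'I_k}) (s : {ffun 'I_k -> L}) :
  balanced eps f -> assignment s -> 0 < hierarchical_cost g f s.
Proof.
move=> bal s_bij; apply: lt_le_trans (balanced_cost_gt0 bal) _.
rewrite -(ler_pMn2r (ltn0Sn 1)) connectivity_cost_pairs // hierarchical_cost_pairs //.
rewrite natr_sum; apply: ler_sum => x _; rewrite natr_sum; apply: ler_sum => y _.
rewrite -(inj_eq (bij_inj s_bij)); exact: edge_cost_ge_separated.
Qed.

(** Adjacent vertices lie in equal or sibling leaves, where a cut edge costs [g d.+1] = 1, so twice
    the cost is the weighted cut. *)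
Lemma swap_partition_cost :
  hierarchical_cost g swap_partition leaf_assignment *+ 2 <= (p.-1 * (k * k))%:R.
Proof.
have leafE (v : V) : leaf_assignment (swap_partition v) = (swap v.1).1.
  by rewrite !ffunE column_labelK.
apply: (@le_trans _ _ (weighted_cut p (fun u : cell => (swap u).1))%:R); last first.
  by rewrite ler_nat -cardL; apply: weighted_cut_swap => //; apply: card_par_fiber.
rewrite hierarchical_cost_pairs //.
have -> : (weighted_cut p (fun u : cell => (swap u).1))%:R =
    \sum_(x : V) \sum_(y | adj x y) ((swap x.1).1 != (swap y.1).1)%:R :> R.
  rewrite (@sum_blowup _ _ _ R (fun u v => ((swap u).1 != (swap v).1)%:R)).
  - rewrite natr_sum; apply: eq_bigr => u _; rewrite natr_sum big_mkcond.
    by apply: eq_bigr => v _; case: eqP => _ /=; rewrite ?mul0rn.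
  - by move=> u; rewrite eqxx.
  - exact: wt_le.
apply: ler_sum => x _; apply: ler_sum => y xy.
rewrite edge_cost_siblings // !leafE //.
rewrite -(ancestor_eq (leqnSn d)); apply/eqP.
move: xy; rewrite /adj /blowup_adj; case: eqP => [-> //|/eqP nxy /andP[_ w]].
by apply: (@swap_siblings _ _ par z0 p) => //; apply: leq_ltn_trans w.
Qed.

(** The central cells fill all [k] leaves, one each, whatever [s] is. Below a child of the root lie
    [n] leaves, so each central cell is separated at depth 1 from [k - n] others; all other edges
    are dropped. *)
Lemma separated_centers_cost (f : {ffun G -> 'I_k}) (s : {ffun 'I_k -> L})
    (phi : cell -> 'I_k) (n : nat) :
  (forall v : V, f v = phi v.1) -> injective (fun x => phi (x, center)) ->
  assignment s -> (b 1 * n)%N = k ->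
  g 1%N * (p.-1 * (k * (k - n)))%:R <= hierarchical_cost g f s *+ 2.
Proof.
move=> f_phi inj s_bij bn.
have b1 : (0 < b 1)%N.
  by rewrite lt0n; apply: contraTneq t_lt_k => b0; rewrite -bn b0.
have g1 : 0 <= g 1%N by rewrite (le_trans ler01) // g_ge1.
pose h x := s (phi (x, center)).
have h_inj : injective h by apply: inj_comp inj; apply: bij_inj.
pose D (u v : cell) : R := g 1%N * (~~ agree 1 (s (phi u)) (s (phi v)))%:R.
have D_ge0 u v : 0 <= D u v by rewrite mulr_ge0.
apply: (@le_trans _ _ (\sum_(x : V) \sum_(y | adj x y) D x.1 y.1)); last first.
  rewrite hierarchical_cost_pairs //; apply: ler_sum => x _; apply: ler_sum => y _.
  by rewrite /D -!f_phi; apply: edge_cost_ge_top.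
rewrite sum_blowup; [|by move=> u; rewrite /D agree_refl mulr0|exact: wt_le].
have restrict (E : cell -> R) : (forall u, 0 <= E u) ->
    \sum_x E (x, center) <= \sum_u E u.
  move=> E0; have -> : \sum_u E u = \sum_x \sum_y E (x, y).
    by rewrite pair_bigA; apply: eq_bigr => -[].
  by apply: ler_sum => x _; rewrite (bigD1 center) //= lerDl sumr_ge0.
apply: (@le_trans _ _
  (\sum_x \sum_x' D (x, center) (x', center) *+ p.-1)); last first.
  apply: le_trans (restrict _ _) => [|u]; last first.
    by apply: sumr_ge0 => v _; rewrite mulrn_wge0.
  apply: ler_sum => x _; apply: le_trans (restrict _ _) => [|v]; last first.
    by rewrite mulrn_wge0.
  by apply: ler_sum => x' _; rewrite /wt /weight /= !eqxx.
have separated x : (\sum_x' (~~ agree 1 (h x) (h x') : nat))%N = (k - n)%N.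
  transitivity (\sum_z (~~ agree 1 (h x) z : nat))%N.
    by rewrite [RHS](reindex_inj h_inj).
  have <- : #|[set z | agree 1 (h x) z]| = n.
    by apply/eqP; rewrite -(eqn_pmul2l b1) bn card_same_child_of_root.
  rewrite -cardL -(cardC [set z | agree 1 (h x) z]) addKn.
  rewrite -sum1_card [RHS]big_mkcond.
  by apply: eq_bigr => z _; rewrite !inE; case: agree.
have row x : \sum_x' D (x, center) (x', center) *+ p.-1 =
    g 1%N * (p.-1 * (k - n))%:R.
  by rewrite sumrMnl -big_distrr /= -natr_sum separated -mulrnAr -mulrnA mulnC.
rewrite (eq_bigr _ (fun x _ => row x)) sumr_const cardL.
by rewrite -mulrnAr -mulrnA -mulnA [((k - n) * k)%N]mulnC.
Qed.

End Construction.

(** * Comparison of the optimum with the two-step method *)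

Lemma g_ge1_of_decreasing (R : realType) (d : nat) (g : nat -> R) :
  (forall i, (1 <= i < d)%N -> g i.+1 <= g i) -> g d = 1 ->
  forall i, (1 <= i <= d)%N -> 1 <= g i.
Proof.
move=> g_dec gd i /andP[i1 id].
have H j : (j <= d - i)%N -> 1 <= g (d - j)%N.
  elim: j => [|j IH] jd; first by rewrite subn0 gd.
  apply: le_trans (IH (ltnW jd)) _.
  have -> : (d - j = (d - j.+1).+1)%N by lia.
  by apply: g_dec; lia.
by have := H (d - i)%N (leqnn _); rewrite subKn.
Qed.

(** Positivity of the optimum and existence of an output keep the ratio from being vacuous; the
    bound holds for every output, however ties are broken. *)
Theorem theorem7p4 (R : realType) (d : nat) (b : nat -> nat) (g : nat -> R)
    (eps : R)
    (hd : (0 < d)%N)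
    (hb : forall i, (1 <= i <= d)%N -> (0 < b i)%N)
    (hbd : (1 < b d)%N)
    (hg : forall i, (1 <= i < d)%N -> g i.+1 <= g i)
    (hgd : g d = 1)
    (heps0 : 0 <= eps)
    (heps1 : eps < 1 / ((nleaves d b)%:R - 1)) :
  exists (G : hypergraph)
         (fopt : {ffun G -> 'I_(nleaves d b)})
         (sopt : {ffun 'I_(nleaves d b) -> node b d}),
    [/\ hierarchical_optimum g eps fopt sopt,
        0 < hierarchical_cost g fopt sopt,
        exists (f : {ffun G -> 'I_(nleaves d b)})
               (s : {ffun 'I_(nleaves d b) -> node b d}),
          two_step_output g eps f s &
        forall (f : {ffun G -> 'I_(nleaves d b)})
               (s : {ffun 'I_(nleaves d b) -> node b d}),
          two_step_output g eps f s ->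
          ((b 1%N)%:R - 1) / (b 1%N)%:R * g 1%N
            * hierarchical_cost g fopt sopt
          <= hierarchical_cost g f s].
Proof.
case: d hd hb hbd hg hgd heps1 => // d' _ b_gt0 b_last g_dec g_last eps_small.
have g_ge1 := g_ge1_of_decreasing g_dec g_last.
have k_gt0 : (0 < nleaves d'.+1 b)%N.
  rewrite /nleaves big_nat; apply: prodn_cond_gt0 => i; exact: b_gt0.
have [z0 _] : exists z0 : node b d'.+1, z0 \in predT.
  by apply/card_gt0P; rewrite card_leaves.
pose columns := @column_partition d' b z0.
pose swapped := @swap_partition d' b z0.
pose leaves := @leaf_assignment d' b.
have columns_balanced : balanced eps columns by apply: column_partition_balanced.
have swapped_balanced : balanced eps swapped by apply: swap_partition_balanced.
have leaves_bij : assignment leaves by apply: leaf_assignment_bij.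
have [[fopt sopt] /= [fopt_bal sopt_bij] opt] := exists_minimizer
  (Q := fun fs : {ffun _ -> _} * {ffun _ -> _} => balanced eps fs.1 /\ assignment fs.2)
  (fun fs => hierarchical_cost g fs.1 fs.2)
  (ex_intro _ (swapped, leaves) (conj swapped_balanced leaves_bij)).
have [f1 f1_bal f1_min] := exists_minimizer (Q := balanced eps)
  (fun f => connectivity_cost R f) (ex_intro _ columns columns_balanced).
have [s1 s1_bij s1_min] := exists_minimizer (Q := @assignment d'.+1 b)
  (fun s => hierarchical_cost g f1 s) (ex_intro _ leaves leaves_bij).
exists _, fopt, sopt; split.
- by split=> // f' s' f'_bal s'_bij; apply: (opt (f', s')).
- exact: (hierarchical_cost_gt0 b_last g_ge1 heps0 eps_small fopt_bal sopt_bij).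
- by exists f1, s1.
move=> f s [f_bal f_min s_bij _].
have [phi f_phi phi_inj] := cheap_partition_cellwise b_last heps0 eps_small
  f_bal (f_min _ columns_balanced).
pose n := #|[set z | agree 1 z0 z]|.
have bn : (b 1 * n)%N = nleaves d'.+1 b := card_same_child_of_root z0.
have b1_neq0 : (b 1%N)%:R != 0 :> R.
  by rewrite pnatr_eq0 -lt0n b_gt0.
rewrite -(ler_pMn2r (ltn0Sn 1)) -mulrnAr.
apply: le_trans _ (separated_centers_cost b_last g_ge1 f_phi phi_inj s_bij bn).
(* The swapped partition caps twice the optimum at (b_d - 1) * k * k. *)
have opt_le := le_trans (ler_wMn2r 2 (opt (swapped, leaves) (conj swapped_balanced leaves_bij)))
  (swap_partition_cost b_last g_last z0).
apply: le_trans (ler_wpM2l _ opt_le) _.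
  rewrite mulr_ge0 ?(le_trans ler01 (g_ge1 _ _)) // divr_ge0 // subr_ge0 ler1n.
  exact: b_gt0.
have n_le : (n <= nleaves d'.+1 b)%N by rewrite -bn leq_pmull // b_gt0.
(* From k = b_1 * n follows k - n = (b_1 - 1) / b_1 * k, so the two bounds coincide and equality is
   what remains to check. *)
rewrite !natrM natrB // -bn natrM le_eqVlt.
by apply/orP; left; apply/eqP; field.
Qed.
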